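(* There exists an effectively defined net-normal set $A\subset\mathbb G$, where $\mathbb G=\bigoplus_{p\text{ prime}}(\mathbb N\cup\{0\},+)$.
   Context: $\mathbb N=\{1,2,\dots\}$. $\mathbb G=\bigoplus_{p\text{ prime}}(\mathbb N\cup\{0\},+)$ is the additive semigroup of sequences $(k_1,k_2,\dots)$ of nonnegative integers with finitely many nonzero terms; it is isomorphic to $(\mathbb N,\times)$ via $(k_1,k_2,\dots)\mapsto p_1^{k_1}p_2^{k_2}\cdots$, where $p_1,p_2,\dots$ are the consecutive primes. An anchored rectangular box in $\mathbb G$ is a set of the form $F=\{0,\dots,k_1\}\times\cdots\times\{0,\dots,k_d\}\times\{0\}\times\{0\}\times\cdots$ (in $(\mathbb N,\times)$: the set of all divisors of $p_1^{k_1}\cdots p_d^{k_d}$). Let $\mathcal F_{\mathbb G}$ be the family of all anchored rectangular boxes, directed by inclusion. For nonempty finite $K\subset\mathbb G$, $B\in\{0,1\}^K$, $x\in\{0,1\}^{\mathbb G}$ and finite $F\subset\mathbb G$ put $\mathsf N(B,x,F)=|\{g\in\mathbb G:(\forall h\in K)\ h+g\in F\text{ and }x_{h+g}=B(h)\}|$. A set $A\subset\mathbb G$ (and its indicator function $\mathbf 1_A$) is net-normal if for every nonempty finite $K\subset\mathbb G$ and every $B\in\{0,1\}^K$ the net $F\mapsto\frac1{|F|}\mathsf N(B,\mathbf 1_A,F)$, indexed by $F\in\mathcal F_{\mathbb G}$, converges to $2^{-|K|}$; i.e., for every $\varepsilon>0$ there is $F_0\in\mathcal F_{\mathbb G}$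 such that $\left|\frac1{|F|}\mathsf N(B,\mathbf 1_A,F)-2^{-|K|}\right|<\varepsilon$ for all $F\in\mathcal F_{\mathbb G}$ with $F\supset F_0$. ''Effectively defined'' is the paper's informal qualifier: the set is given by an inductive construction which determines, for every element, in finitely many inductive steps whether it belongs to the set. *)

(* Defs.v *)
From HB Require Import structures.
From mathcomp Require Import all_boot all_order all_algebra finmap.
From mathcomp Require Import all_classical all_reals.

Set Implicit Arguments.
Unset Strict Implicit.
Unset Printing Implicit Defensive.

Import Order.TTheory GRing.Theory Num.Theory.

Local Open Scope classical_set_scope.

(* Finitely supported sequences of natural numbers, indexed from 0:
   coordinate i is the exponent of the prime [nth_prime i]. *)
Definition GG : Type := {fsfun nat -> nat with 0%N}.

HB.instance Definition _ := Choice.on GG.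

Definition gcoord (g : GG) : nat -> nat := fun i => g i.
Coercion gcoord : GG >-> Funclass.

Definition gzero : GG := [fsfun].

Definition gadd (g h : GG) : GG :=
  [fsfun i in (finsupp g `|` finsupp h)%fset => (g i + h i)%N].

Lemma gzeroE i : gzero i = 0%N.
Proof. by rewrite /gcoord fsfun_dflt // finsupp0. Qed.

Lemma gaddE g h i : gadd g h i = (g i + h i)%N.
Proof.
rewrite /gcoord /gadd fsfunE in_fsetU.
by case: ifPn => //; rewrite negb_or => /andP[/fsfun_dflt -> /fsfun_dflt ->].
Qed.

Lemma gaddA : associative gadd.
Proof. by move=> x y z; apply/fsfunP => i; rewrite -!/(gcoord _ i) !gaddE addnA. Qed.

Lemma gaddC : commutative gadd.
Proof. by move=> x y; apply/fsfunP => i; rewrite -!/(gcoord _ i) !gaddE addnC. Qed.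

Lemma gadd0 : left_id gzero gadd.
Proof. by move=> x; apply/fsfunP => i; rewrite -!/(gcoord _ i) gaddE gzeroE. Qed.

HB.instance Definition _ := GRing.isNmodule.Build GG gaddA gaddC gadd0.

(* {0..k_0} x ... x {0..k_(d-1)} x {0} x {0} x ..., where d = size k *)
Definition anchored_box (k : seq nat) : set GG :=
  [set g : GG | forall i : nat, (g i <= nth 0%N k i)%N].

Definition anchored_boxes : set {fset GG} :=
  [set F | exists k : seq nat, [set` F] = anchored_box k].

(* The set below is finite as soon as K is nonempty, because the translations
   of GG are injective; fset_set sends infinite sets to fset0. *)
Definition occurrences (K : {fset GG}) (B : {ffun K -> bool})
    (x : GG -> bool) (F : {fset GG}) : nat :=
  #|` fset_set [set g : GG | forall h : K,
        (val h + g)%R \in F /\ x (val h + g)%R = B h] |%fset.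

Definition net_normal (R : realType) (A : set GG) : Prop :=
  forall (K : {fset GG}) (B : {ffun K -> bool}), K != fset0%fset ->
  forall eps : R, (0 < eps)%R ->
  exists2 F0 : {fset GG}, anchored_boxes F0 &
    forall F : {fset GG}, anchored_boxes F -> (F0 `<=` F)%fset ->
      (`| (occurrences B (fun g => g \in A) F)%:R / (#|` F|%fset)%:R
          - 2^-1 ^+ #|` K|%fset | < eps)%R.

(* Total recursive functions: the last rule is minimization of a regular
   function.  All rules are stated up to pointwise equality. *)
Inductive recursive : forall n : nat, (n.-tuple nat -> nat) -> Prop :=
| Rec_zero n (f : n.-tuple nat -> nat) :
    (forall v, f v = 0%N) -> recursive f
| Rec_succ (f : 1.-tuple nat -> nat) :
    (forall v, f v = (tnth v ord0).+1) -> recursive f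
| Rec_proj n (i : 'I_n) (f : n.-tuple nat -> nat) :
    (forall v, f v = tnth v i) -> recursive f
| Rec_comp m n (h : m.-tuple nat -> nat) (gs : 'I_m -> n.-tuple nat -> nat)
    (f : n.-tuple nat -> nat) :
    recursive h -> (forall i, recursive (gs i)) ->
    (forall v, f v = h [tuple gs i v | i < m]) -> recursive f
| Rec_prec n (g : n.-tuple nat -> nat) (h : n.+2.-tuple nat -> nat)
    (f : n.+1.-tuple nat -> nat) :
    recursive g -> recursive h ->
    (forall v : n.-tuple nat, f [tuple of 0%N :: v] = g v) ->
    (forall (a : nat) (v : n.-tuple nat),
       f [tuple of a.+1 :: v] = h [tuple of a :: f [tuple of a :: v] :: v]) ->
    recursive f
| Rec_mu n (g : n.+1.-tuple nat -> nat) (f : n.-tuple nat -> nat) :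
    recursive g ->
    (forall v : n.-tuple nat, g [tuple of f v :: v] = 0%N) ->
    (forall (v : n.-tuple nat) (a : nat), (a < f v)%N ->
       g [tuple of a :: v] <> 0%N) ->
    recursive f.

Lemma ex_prime_above (n : nat) : exists p, (n < p)%N && prime p.
Proof. by have [p np pp] := prime_above n; exists p; rewrite np pp. Qed.

Definition next_prime (n : nat) : nat := ex_minn (ex_prime_above n).

(* nth_prime 0 = 2, nth_prime 1 = 3, nth_prime 2 = 5, ... *)
Definition nth_prime (i : nat) : nat := iter i.+1 next_prime 0%N.

(* The isomorphism of GG onto the positive integers under multiplication. *)
Definition godel (g : GG) : nat :=
  (\prod_(i <- finsupp g) nth_prime i ^ g i)%N.

(* A is given by an algorithm: membership in A is a (total) recursive function
   of the positive integer representing an element of GG. *)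
Definition effectively_defined (A : set GG) : Prop :=
  exists2 f : 1.-tuple nat -> nat, recursive f &
    forall g : GG, f [tuple godel g] = (g \in A) :> nat.

(* Main.v *)
From HB Require Import structures.
Require Import Defs.
From mathcomp Require Import all_boot all_order all_algebra finmap.
From mathcomp Require Import all_classical all_reals.
From mathcomp Require Import zify lra.

(** Write an element of [GG] as a number n through [godel], and let k be its
    exponent at the prime 2.  The idea is to make the frequency of every
    pattern correct along each line on which only k varies, at a rate that is
    the same for all lines.  Boxes are unions of initial segments of such
    lines, so the other sides of the box never have to be controlled, apart
    from a boundary effect.  (Uniformity is what a random set lacks: a fixed
    box can be prolonged by one unit in infinitely many directions, and a
    random set behaves atypically in some of them.)

    The colour of n is one binary digit of k.  A slowly growing level
    t = [level k] is chosen; the residues modulo 2 ^ t of the exponents of n at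
    the primes below t are packed into a number [slot t n] < 2 ^ (t * t), and
    the colour is the digit of index [slot t n] of the quotient k %/ 2 ^ t.
    Let u range over a finite set of numbers.  Once t exceeds all of them, the
    slots of the numbers u * n are pairwise distinct for every n
    ([slot_separates]).  Suppose that k runs through 2 ^ t consecutive residues
    and, for each of them, through 2 ^ 2 ^ (t * t) consecutive quotients w.
    If adding the 2-exponents of the numbers u produces no carry into w, the
    colours of the numbers u * n * 2 ^ k are digits of w with distinct indices
    that depend on the residue only ([colour_period]), so every pattern occurs
    exactly as often as it should ([count_bits], [excess_residue]); a carry
    concerns a bounded number of the 2 ^ t residues.  Hence the error over one
    period of length 2 ^ [period_log t] is a vanishing proportion of it
    ([excess_period]).  The level t is used for k between 4 ^ [period_log t]
    and 4 ^ [period_log t.+1]: these bounds are multiples of the period of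
    level t, and the period is at most the square root of k, so an incomplete
    last period is negligible ([greedy_sum_bound], [excess_mean]).

    Summation over the lines of a box ([sum_box_fibers]) gives the frequency in
    the box ([box_matches_le]), and the translates that leave the box are few
    as soon as its sides are long in the finitely many directions occurring in
    the pattern ([box_shift_bad_le]).  Finally the colour is built from bounded
    sums, products and maxima of arithmetic functions, hence is recursive
    ([recursive_colour]). *)

Set Implicit Arguments.
Unset Strict Implicit.
Unset Printing Implicit Defensive.

Import Order.TTheory GRing.Theory Num.Theory.

(** * The colouring *)

(** The binary logarithm of a period of level t: 2 ^ t residues, times the
    2 ^ 2 ^ (t * t) possible blocks of 2 ^ (t * t) binary digits. *)
Definition period_log t := t + 2 ^ (t * t).

(** The threshold of level t is the square of the period of level t; being a
    power of 2 it is a multiple of that period and of the previous one. *)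
Definition level k := \max_(t < k | 4 ^ period_log t <= k) t.

(** A number whose digits in base 2 ^ t are the exponents of n modulo 2 ^ t;
    indices p that are not prime contribute 0, as [logn p n] does. *)
Definition slot t n := \sum_(p < t) (logn p n %% 2 ^ t) * (2 ^ t) ^ p.

(** The binary digit of index [slot] of k %/ 2 ^ t. *)
Definition colour n : bool :=
  let k := logn 2 n in odd (k %/ 2 ^ (level k + slot (level k) n)).

(** * Closure properties of recursive functions *)

Lemma recursive_ext n (f g : n.-tuple nat -> nat) :
  f =1 g -> recursive f -> recursive g.
Proof. by move=> /funext ->. Qed.

Lemma recursive_const n c : recursive (fun _ : n.-tuple nat => c).
Proof.
elim: c => [|c IHc]; first exact: Rec_zero.
apply: (Rec_comp (h := fun v => (tnth v ord0).+1) (gs := fun _ _ => c)) => //.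
  exact: Rec_succ.
by move=> v; rewrite tnth_mktuple.
Qed.

Lemma recursive_proj n (i : 'I_n) : recursive (fun v : n.-tuple nat => tnth v i).
Proof. exact: Rec_proj. Qed.

Definition recursive1 (f : nat -> nat) :=
  recursive (fun v : 1.-tuple nat => f (tnth v ord0)).

Definition recursive2 (f : nat -> nat -> nat) :=
  recursive (fun v : 2.-tuple nat => f (tnth v ord0) (tnth v ord_max)).

Lemma recursive_comp1 n f (E : n.-tuple nat -> nat) :
  recursive1 f -> recursive E -> recursive (fun v => f (E v)).
Proof.
move=> rf rE; apply: (Rec_comp (gs := fun _ => E) rf) => // v.
by rewrite tnth_mktuple.
Qed.

Lemma recursive_comp2 n f (E1 E2 : n.-tuple nat -> nat) :
  recursive2 f -> recursive E1 -> recursive E2 ->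
  recursive (fun v => f (E1 v) (E2 v)).
Proof.
move=> rf r1 r2.
apply: (Rec_comp (gs := fun i : 'I_2 => if i == ord0 then E1 else E2) rf).
  by move=> i; case: ifP.
by move=> v; rewrite !tnth_mktuple.
Qed.

Lemma recursive_weaken n (E : n.-tuple nat -> nat) :
  recursive E -> recursive (fun v : n.+1.-tuple nat => E (behead_tuple v)).
Proof.
move=> rE.
apply: (Rec_comp (gs := fun (i : 'I_n) v => tnth v (lift ord0 i)) rE).
  by move=> i; apply: recursive_proj.
move=> v; congr E; apply: eq_from_tnth => i; rewrite tnth_mktuple.
by rewrite [v in RHS]tuple_eta tnthS.
Qed.

Lemma recursive_head n : recursive (fun v : n.+1.-tuple nat => thead v).
Proof. exact: recursive_proj. Qed.

(** Primitive recursion on a computed bound E, with the parameters kept as a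
    tuple: the form in which iterations are used below. *)
Lemma recursive_rec n (g : n.-tuple nat -> nat) (h : nat -> nat -> n.-tuple nat -> nat)
    (f : nat -> n.-tuple nat -> nat) (E : n.-tuple nat -> nat) :
  recursive g ->
  recursive (fun v : n.+2.-tuple nat =>
    h (thead v) (thead (behead_tuple v)) (behead_tuple (behead_tuple v))) ->
  recursive E ->
  (forall v, f 0 v = g v) -> (forall a v, f a.+1 v = h a (f a v) v) ->
  recursive (fun v => f (E v) v).
Proof.
move=> rg rh rE f0 fS.
have rf : recursive (fun v : n.+1.-tuple nat => f (thead v) (behead_tuple v)).
  apply: (Rec_prec rg rh) => [v|a v]; rewrite ?theadE.
    by rewrite -f0; congr f; apply: val_inj.
  have -> : behead_tuple [tuple of a.+1 :: v] = v by apply: val_inj.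
  rewrite fS; congr (h _ (f _ _) _); exact: val_inj.
apply: (Rec_comp (gs := fun i : 'I_n.+1 =>
    if unlift ord0 i is Some j then fun v : n.-tuple nat => tnth v j else E) rf).
  by move=> i; case: unliftP => *; [apply: recursive_proj|].
move=> v.
have -> : [tuple (if unlift ord0 i is Some j then fun v : n.-tuple nat => tnth v j
                 else E) v | i < n.+1] = [tuple of E v :: v].
  apply: eq_from_tnth => i; rewrite tnth_mktuple.
  by case: unliftP => [j|] ->; rewrite ?tnth0 ?tnthS.
by rewrite theadE; congr f; apply: val_inj.
Qed.

Lemma recursive_addn : recursive2 addn.
Proof.
apply: (recursive_ext (f := fun v => iter (tnth v ord0) succn (tnth v ord_max))).
  by move=> v; rewrite iter_succn addnC.
apply: (@recursive_rec 2 (fun v => tnth v ord_max) (fun _ y _ => y.+1)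
   (fun a v => iter a succn (tnth v ord_max))) => //; try exact: recursive_proj.
apply: (recursive_comp1 (f := succn)); first exact: Rec_succ.
by apply: recursive_weaken; apply: recursive_head.
Qed.

Lemma recursive_predn : recursive1 predn.
Proof.
apply: (@recursive_rec 1 (fun=> 0) (fun a _ _ => a) (fun a _ => a.-1)) => //.
- exact: recursive_const.
- exact: recursive_head.
- exact: recursive_proj.
Qed.

Lemma recursive_subn : recursive2 subn.
Proof.
apply: (@recursive_rec 2 (fun v => tnth v ord0) (fun _ y _ => y.-1)
   (fun a v => tnth v ord0 - a)) => //; try exact: recursive_proj.
- by apply: (recursive_comp1 recursive_predn); apply: recursive_weaken; apply: recursive_head.
- by move=> v; rewrite subn0.
- by move=> a v; rewrite subnS.
Qed.

(** Bounded iteration of a recursive monoid law.  Sums, products and maxima are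
    instances, and they replace explicit recursions for quotients, primality
    and valuations. *)
Lemma recursive_big n (op : nat -> nat -> nat) idx
    (F : nat -> n.-tuple nat -> nat) (E : n.-tuple nat -> nat) :
  associative op -> left_id idx op -> right_id idx op ->
  recursive2 op ->
  recursive (fun v : n.+1.-tuple nat => F (thead v) (behead_tuple v)) ->
  recursive E ->
  recursive (fun v => \big[op/idx]_(i < E v) F i v).
Proof.
move=> opA op0 opr rop rF rE.
(* splitting off the last term of the iteration requires op to be a
   registered monoid law *)
pose opL := Monoid.isLaw.Build nat idx op opA op0 opr.
pose opM : Monoid.law idx := HB.pack op opL.
apply: (@recursive_rec n (fun=> idx) (fun a y v => op y (F a v))
   (fun a v => \big[op/idx]_(i < a) F i v)) => //.
- exact: recursive_const.
- apply: (recursive_comp2 rop).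
    by apply: recursive_weaken; apply: recursive_head.
  pose gs (i : 'I_n.+1) (v : n.+2.-tuple nat) :=
    if unlift ord0 i is Some j then tnth (behead_tuple (behead_tuple v)) j
    else thead v.
  apply: (Rec_comp (gs := gs) rF) => [i|v].
    rewrite /gs; case: unliftP => [j|] _; last exact: recursive_head.
    exact: (recursive_weaken (recursive_weaken (recursive_proj j))).
  congr F; first by rewrite /thead tnth_mktuple /gs unlift_none.
  apply: eq_from_tnth => j.
  have := tnthS (thead (mktuple (gs^~ v))) (behead_tuple (mktuple (gs^~ v))) j.
  by rewrite -tuple_eta tnth_mktuple /gs liftK => <-.
- by move=> v; rewrite big_ord0.
- by move=> a v; rewrite (big_ord_recr (op := opM)).
Qed.

(** * Recursiveness of the colouring *)

Lemma recursive_muln : recursive2 muln.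
Proof.
apply: (recursive_ext
    (f := fun v => \big[addn/0]_(i < tnth v ord0) tnth v ord_max)).
  by move=> v; rewrite sum_nat_const card_ord.
apply: (@recursive_big 2 addn 0 (fun _ v => tnth v ord_max)).
- exact: addnA.
- exact: add0n.
- exact: addn0.
- exact: recursive_addn.
- exact: (recursive_weaken (recursive_proj _)).
- exact: recursive_proj.
Qed.

Lemma recursive_sum n (F : nat -> n.-tuple nat -> nat) (E : n.-tuple nat -> nat) :
  recursive (fun v : n.+1.-tuple nat => F (thead v) (behead_tuple v)) ->
  recursive E ->
  recursive (fun v => \sum_(i < E v) F i v).
Proof.
apply: recursive_big.
- exact: addnA.
- exact: add0n.
- exact: addn0.
- exact: recursive_addn.
Qed.

Lemma recursive_prod n (F : nat -> n.-tuple nat -> nat) (E : n.-tuple nat -> nat) :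
  recursive (fun v : n.+1.-tuple nat => F (thead v) (behead_tuple v)) ->
  recursive E ->
  recursive (fun v => \prod_(i < E v) F i v).
Proof.
apply: recursive_big.
- exact: mulnA.
- exact: mul1n.
- exact: muln1.
- exact: recursive_muln.
Qed.

Lemma recursive_maxn : recursive2 maxn.
Proof.
apply: (recursive_ext (f := fun v =>
    tnth v ord0 + (tnth v ord_max - tnth v ord0))).
  by move=> v; rewrite maxnE.
apply: (recursive_comp2 recursive_addn); first exact: recursive_proj.
by apply: (recursive_comp2 recursive_subn); apply: recursive_proj.
Qed.

Lemma recursive_max n (F : nat -> n.-tuple nat -> nat) (E : n.-tuple nat -> nat) :
  recursive (fun v : n.+1.-tuple nat => F (thead v) (behead_tuple v)) ->
  recursive E ->
  recursive (fun v => \max_(i < E v) F i v).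
Proof.
apply: recursive_big.
- exact: maxnA.
- exact: max0n.
- exact: maxn0.
- exact: recursive_maxn.
Qed.

Lemma recursive_expn : recursive2 expn.
Proof.
apply: (recursive_ext
    (f := fun v => \prod_(i < tnth v ord_max) tnth v ord0)).
  by move=> v; rewrite prod_nat_const card_ord.
apply: (@recursive_prod 2 (fun _ v => tnth v ord0)); last exact: recursive_proj.
exact: (recursive_weaken (recursive_proj _)).
Qed.

Lemma recursive_leq : recursive2 leq.
Proof.
apply: (recursive_ext (f := fun v =>
    1 - (tnth v ord0 - tnth v ord_max))).
  by move=> v; rewrite /leq; case: (_ - tnth v ord_max).
apply: (recursive_comp2 recursive_subn); first exact: recursive_const.
by apply: (recursive_comp2 recursive_subn); apply: recursive_proj.
Qed.

Lemma sum_ltn_minn m c : \sum_(i < m) (i < c) = minn m c.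
Proof.
elim: m => [|m IHm]; first by rewrite big_ord0 min0n.
by rewrite big_ord_recr /= IHm; case: ltnP; lia.
Qed.

Lemma recursive_divn : recursive2 divn.
Proof.
apply: (recursive_ext (f := fun v => \sum_(i < tnth v ord0)
    (1 <= tnth v ord_max) * (i.+1 * tnth v ord_max <= tnth v ord0))).
  move=> v; set m := tnth v ord0; set d := tnth v ord_max.
  case: (posnP d) => [->|d0].
    by rewrite divn0 big1 // => i _; rewrite ltnn.
  under eq_bigr do rewrite mul1n -leq_divRL //.
  by rewrite sum_ltn_minn; apply/minn_idPr; rewrite leq_div.
apply: (@recursive_sum 2 (fun i v =>
  (1 <= tnth v ord_max) * (i.+1 * tnth v ord_max <= tnth v ord0)));
  last exact: recursive_proj.
pose W i := recursive_weaken (@recursive_proj 2 i).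
apply: (recursive_comp2 recursive_muln); apply: (recursive_comp2 recursive_leq).
- exact: recursive_const.
- exact: W.
- apply: (recursive_comp2 recursive_muln); last exact: W.
  by apply: (recursive_comp1 (f := succn)); [apply: Rec_succ|apply: recursive_head].
- exact: W.
Qed.

Lemma recursive_modn : recursive2 modn.
Proof.
apply: (recursive_ext (f := fun v =>
    tnth v ord0 - tnth v ord0 %/ tnth v ord_max * tnth v ord_max)).
  by move=> v; rewrite [X in X - _](divn_eq _ (tnth v ord_max)) addKn.
apply: (recursive_comp2 recursive_subn); first exact: recursive_proj.
apply: (recursive_comp2 recursive_muln); last exact: recursive_proj.
by apply: (recursive_comp2 recursive_divn); apply: recursive_proj.
Qed.

Lemma recursive_dvdn : recursive2 dvdn.
Proof.
apply: (recursive_ext (f := fun v => tnth v ord_max %% tnth v ord0 <= 0)).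
  by move=> v; rewrite leqn0.
apply: (recursive_comp2 recursive_leq); last exact: recursive_const.
by apply: (recursive_comp2 recursive_modn); apply: recursive_proj.
Qed.

Lemma recursive_odd : recursive1 odd.
Proof.
apply: (recursive_ext (f := fun v => tnth v ord0 %% 2)).
  by move=> v; rewrite modn2.
by apply: (recursive_comp2 recursive_modn);
  [apply: recursive_proj | apply: recursive_const].
Qed.

(** Trial division, as a product of truth values. *)
Lemma prime_prod p :
  prime p = (2 <= p) * \prod_(d < p) (1 - (2 <= d) * (d %| p)) :> nat.
Proof.
case: (leqP 2 p) => p2; last by rewrite mul0n; case: p p2 => [|[]].
rewrite mul1n; have [pp|npp] := boolP (prime p).
  rewrite big1 // => d _; case: (leqP 2 d) => // d2.
  case: (boolP (d %| p)) => // dp; move: d2 (ltn_ord d).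
  by case/primeP: pp => _ /(_ d dp) /pred2P[] ->; rewrite ltnn.
have pdp : pdiv p < p.
  rewrite ltn_neqAle pdiv_leq ?andbT; last exact: ltnW.
  by apply: contraNneq npp => <-; exact: pdiv_prime.
by rewrite (bigD1 (Ordinal pdp)) //= pdiv_dvd prime_gt1 ?pdiv_prime.
Qed.

Lemma recursive_prime : recursive1 prime.
Proof.
apply: (recursive_ext (f := fun v => (2 <= tnth v ord0) *
    \prod_(d < tnth v ord0) (1 - (2 <= d) * (d %| tnth v ord0)))).
  by move=> v; rewrite -prime_prod.
apply: (recursive_comp2 recursive_muln).
  apply: (recursive_comp2 recursive_leq); first exact: recursive_const.
  exact: recursive_proj.
apply: (@recursive_prod 1 (fun d v => 1 - (2 <= d) * (d %| tnth v ord0)));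
  last exact: recursive_proj.
apply: (recursive_comp2 recursive_subn); first exact: recursive_const.
apply: (recursive_comp2 recursive_muln).
  apply: (recursive_comp2 recursive_leq); first exact: recursive_const.
  exact: recursive_head.
apply: (recursive_comp2 recursive_dvdn); first exact: recursive_head.
exact: (recursive_weaken (recursive_proj _)).
Qed.

Lemma logn_max p n : logn p n = prime p * \max_(e < n) e * (p ^ e %| n).
Proof.
have [pp|npp] := boolP (prime p); last by rewrite lognE (negbTE npp).
case: (posnP n) => [->|n0]; first by rewrite big_ord0 logn0.
rewrite mul1n; apply/eqP; rewrite eqn_leq; apply/andP; split; last first.
  apply/bigmax_leqP => e _; rewrite pfactor_dvdn //.
  by case: (leqP e (logn p n)) => [le_e|_]; rewrite ?muln1 ?muln0.
apply: leq_trans (leq_bigmax (Ordinal (ltn_logl p n0))) => /=.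
by rewrite pfactor_dvdnn muln1.
Qed.

Lemma recursive_logn : recursive2 logn.
Proof.
apply: (recursive_ext (f := fun v => prime (tnth v ord0) *
    \max_(e < tnth v ord_max) e * (tnth v ord0 ^ e %| tnth v ord_max))).
  by move=> v; rewrite -logn_max.
apply: (recursive_comp2 recursive_muln).
  exact: (recursive_comp1 recursive_prime (recursive_proj _)).
apply: (@recursive_max 2
  (fun e v => e * (tnth v ord0 ^ e %| tnth v ord_max))); last exact: recursive_proj.
pose W i := recursive_weaken (@recursive_proj 2 i).
apply: (recursive_comp2 recursive_muln); first exact: recursive_head.
apply: (recursive_comp2 recursive_dvdn); last exact: W.
apply: (recursive_comp2 recursive_expn); [exact: W|exact: recursive_head].
Qed.

Lemma recursive_level : recursive1 level.
Proof.
apply: (recursive_ext (f := fun v =>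
    \max_(t < tnth v ord0) t * (4 ^ period_log t <= tnth v ord0))).
  move=> v; rewrite /level [RHS]big_mkcond; apply: eq_bigr => t _.
  by case: ifP => _; rewrite ?muln1 ?muln0.
apply: (@recursive_max 1
  (fun t v => t * (4 ^ period_log t <= tnth v ord0))); last exact: recursive_proj.
apply: (recursive_comp2 recursive_muln); first exact: recursive_head.
apply: (recursive_comp2 recursive_leq);
  last exact: (recursive_weaken (recursive_proj _)).
apply: (recursive_comp2 recursive_expn); first exact: recursive_const.
apply: (recursive_comp2 recursive_addn); first exact: recursive_head.
apply: (recursive_comp2 recursive_expn); first exact: recursive_const.
by apply: (recursive_comp2 recursive_muln); apply: recursive_head.
Qed.

Lemma recursive_slot : recursive2 slot.
Proof.
apply: (@recursive_sum 2 (fun p v =>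
  (logn p (tnth v ord_max) %% 2 ^ tnth v ord0) * (2 ^ tnth v ord0) ^ p));
  last exact: recursive_proj.
pose W i := recursive_weaken (@recursive_proj 2 i).
have W2 : recursive (fun v : 3.-tuple nat => 2 ^ tnth (behead_tuple v) ord0).
  by apply: (recursive_comp2 recursive_expn); [apply: recursive_const|apply: W].
apply: (recursive_comp2 recursive_muln).
  apply: (recursive_comp2 recursive_modn) => //.
  by apply: (recursive_comp2 recursive_logn); [apply: recursive_head|apply: W].
by apply: (recursive_comp2 recursive_expn) => //; apply: recursive_head.
Qed.

Lemma recursive_colour : recursive1 colour.
Proof.
have rk : recursive (fun v : 1.-tuple nat => logn 2 (tnth v ord0)).
  by apply: (recursive_comp2 recursive_logn);
    [apply: recursive_const|apply: recursive_proj].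
have rt := recursive_comp1 recursive_level rk.
apply: (recursive_comp1 recursive_odd).
apply: (recursive_comp2 recursive_divn) => //.
apply: (recursive_comp2 recursive_expn); first exact: recursive_const.
apply: (recursive_comp2 recursive_addn) => //.
by apply: (recursive_comp2 recursive_slot) => //; apply: recursive_proj.
Qed.

(** * Levels, digits and bits *)

Lemma level_eq t k :
  4 ^ period_log t <= k < 4 ^ period_log t.+1 -> level k = t.
Proof.
move=> /andP[le_tk lt_kt].
have tk : t < k.
  apply: leq_trans le_tk; apply: leq_ltn_trans (ltn_expl _ _) => //.
  exact: leq_addr.
apply/eqP; rewrite eqn_leq; apply/andP; split; last first.
  exact: (leq_bigmax_cond (Ordinal tk) le_tk).
apply/bigmax_leqP => i le_ik; rewrite leqNgt; apply/negP => lt_ti.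
have := leq_ltn_trans le_ik lt_kt; rewrite ltn_exp2l //.
by apply/negP; rewrite -leqNgt leq_add // leq_exp2l // leq_mul.
Qed.

Lemma digits_lt b s (d : nat -> nat) :
  (forall p, d p < b) -> \sum_(p < s) d p * b ^ p < b ^ s.
Proof.
move=> db; elim: s => [|s IHs]; first by rewrite big_ord0.
rewrite big_ord_recr /= expnS.
have : (d s).+1 * b ^ s <= b * b ^ s by rewrite leq_mul2r db orbT.
by rewrite mulSn; apply: leq_trans; rewrite ltn_add2r.
Qed.

(** Uniqueness of base b expansions: the top digit is a quotient by b ^ s. *)
Lemma digits_inj b s (d e : nat -> nat) :
  (forall p, d p < b) -> (forall p, e p < b) ->
  \sum_(p < s) d p * b ^ p = \sum_(p < s) e p * b ^ p ->
  forall p, p < s -> d p = e p.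
Proof.
move=> db eb; elim: s => [//|s IHs].
rewrite !big_ord_recr /= => eq_de.
have b0 : 0 < b ^ s by rewrite expn_gt0 (leq_trans _ (db 0)).
have := congr1 (fun n => n %/ b ^ s) eq_de.
rewrite !divnDMl // !divn_small ?digits_lt // !add0n => eq_s.
move: eq_de; rewrite eq_s => /addIn /IHs IH p.
by rewrite ltnS leq_eqVlt => /predU1P[->|/IH].
Qed.

Lemma slot_lt t n : slot t n < 2 ^ (t * t).
Proof. 
rewrite expnM; apply: (digits_lt t (d := fun p => logn p n %% 2 ^ t)) => p.
by rewrite ltn_mod expn_gt0. Qed.

Lemma slot_inj t m n : slot t m = slot t n ->
  forall p, p < t -> logn p m = logn p n %[mod 2 ^ t].
Proof.
move=> eq_s p pt.
apply: (@digits_inj (2 ^ t) t (fun p => logn p m %% 2 ^ t)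
  (fun p => logn p n %% 2 ^ t)) pt => // q; by rewrite ltn_mod expn_gt0.
Qed.

(** Euclidean division by m, as a reindexing. *)
Lemma big_split_residue (T : Type) (idx : T) (op : Monoid.com_law idx) m n
    (G : nat -> T) :
  \big[op/idx]_(k < m * n) G k
  = \big[op/idx]_(j < m) \big[op/idx]_(w < n) G (j + m * w).
Proof.
rewrite exchange_big /=; elim: n => [|n IHn]; first by rewrite muln0 !big_ord0.
rewrite big_ord_recr /= -IHn mulnS addnC big_split_ord /=.
by congr (op _ _); apply: eq_bigr => j _; rewrite addnC.
Qed.

(** Expanding the product on the right chooses one bit for every index p, and
    the choices are the binary expansions of the numbers below 2 ^ L. *)
Lemma sum_prod_bits L (F : nat -> bool -> nat) :
  \sum_(w < 2 ^ L) \prod_(p < L) F p (odd (w %/ 2 ^ p))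
  = \prod_(p < L) (F p false + F p true).
Proof.
elim: L F => [|L IHL] F; first by rewrite big_ord1 !big_ord0.
rewrite expnS.
rewrite (big_split_residue _ _ _ (fun w => \prod_(p < L.+1) F p (odd (w %/ 2 ^ p)))).
rewrite exchange_big [RHS]big_ord_recl /= -(IHL (fun p => F p.+1)) big_distrr /=.
apply: eq_bigr => w _; rewrite 2!big_ord_recl big_ord0 addn0.
have bitS (b : bool) : \prod_(p < L.+1) F p (odd ((b + 2 * w) %/ 2 ^ p))
    = F 0 b * \prod_(p < L) F p.+1 (odd (w %/ 2 ^ p)).
  rewrite big_ord_recl expn0 divn1 oddD oddM oddb addbF; congr (_ * _).
  apply: eq_bigr => p _; rewrite expnS divnMA addnC mulnC divnMDl //.
  by rewrite [b %/ 2]divn_small ?addn0 //; case: b.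
by rewrite (bitS false) (bitS true) mulnDl.
Qed.

Lemma prod_bool L (b : nat -> bool) :
  \prod_(p < L) b p = [forall p : 'I_L, b p] :> nat.
Proof.
case: forallP => [bT|/forallP].
  by rewrite big1 // => p _; rewrite bT.
rewrite negb_forall => /existsP[p /negbTE bp].
by rewrite (bigD1 p) //= bp.
Qed.

(** Binary digits with distinct indices are independent: among the numbers
    below 2 ^ L, prescribing the digits of index [c i] keeps one number out of
    2 ^ #|I|. *)
Lemma count_bits (I : finType) (c : I -> nat) (B : I -> bool) L :
  injective c -> (forall i, c i < L) ->
  2 ^ #|I| * \sum_(w < 2 ^ L) [forall i, odd (w %/ 2 ^ c i) == B i] = 2 ^ L.
Proof.
move=> c_inj cL.
pose F p b : nat := [forall i, (c i == p) ==> (b == B i)].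
have -> : \sum_(w < 2 ^ L) [forall i, odd (w %/ 2 ^ c i) == B i]
    = \sum_(w < 2 ^ L) \prod_(p < L) F p (odd (w %/ 2 ^ p)).
  apply: eq_bigr => w _.
  rewrite (prod_bool L (fun p => [forall i, (c i == p) ==> (odd (w %/ 2 ^ p) == B i)])).
  congr nat_of_bool; apply/forallP/forallP => H => [p|i].
    by apply/forallP => i; apply/implyP => /eqP <-.
  by have /forallP/(_ i) := H (Ordinal (cL i)); rewrite eqxx.
rewrite sum_prod_bits.
pose S := [set Ordinal (cL i) | i in I].
(* after multiplication by 2 ^ #|S| every index p < L contributes a factor 2:
   two free values off S, one prescribed value and a compensating 2 on S *)
have <- : #|S| = #|I|.
  by rewrite card_imset // => i j [/c_inj].
rewrite -[2 ^ #|S|]prod_nat_const big_mkcond -big_split /=.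
rewrite -[in RHS](card_ord L) -prod_nat_const; apply: eq_bigr => p _.
rewrite /F; case: ifP => [/imsetP[i _ ->] /=|pS].
  have H b : [forall j, (c j == c i) ==> (b == B j)] = (b == B i).
    apply/forallP/idP => [/(_ i)|/eqP -> j]; first by rewrite eqxx.
    by apply/implyP => /eqP/c_inj ->.
  by rewrite !H; case: (B i).
have H b : [forall j, (c j == p) ==> (b == B j)].
  apply/forallP => j; apply/implyP => /eqP cj; move/negbT/negP: pS; case.
  by apply/imsetP; exists j => //; apply: val_inj.
by rewrite !H.
Qed.

(** * The colouring over one period *)

Lemma slot_mul_pow2 t n j c : 0 < n ->
  slot t (n * 2 ^ (j + 2 ^ t * c)) = slot t (n * 2 ^ j).
Proof.
move=> n0; apply: eq_bigr => p _; congr (_ * _).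
rewrite !lognM ?expn_gt0 // !lognX mulnDl addnA -mulnA addnC [2 ^ t * _]mulnC.
by rewrite modnMDl.
Qed.

Lemma odd_divn_pow2D L c w a : c < L ->
  odd ((w + 2 ^ L * a) %/ 2 ^ c) = odd (w %/ 2 ^ c).
Proof.
move=> cL; have -> : 2 ^ L * a = 2 * (2 ^ (L - c.+1) * a) * 2 ^ c.
  by rewrite -{1}(subnKC cL) expnD expnS; nia.
by rewrite addnC divnMDl ?expn_gt0 // oddD mul2n odd_double.
Qed.

(** Inside a period of level t starting at a, write the exponent of 2 as
    j + 2 ^ t * w.  The hypothesis on j excludes a carry from the exponent of 2
    in n to w, so the colour is a digit of w, and its index does not depend on
    w. *)
Lemma colour_period t a n j w :
  0 < n -> 2 ^ period_log t %| a ->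
  4 ^ period_log t <= a -> a + 2 ^ period_log t <= 4 ^ period_log t.+1 ->
  j + logn 2 n < 2 ^ t -> w < 2 ^ 2 ^ (t * t) ->
  colour (n * 2 ^ (a + (j + 2 ^ t * w))) = odd (w %/ 2 ^ slot t (n * 2 ^ j)).
Proof.
move=> n0 /dvdnP[a' def_a] le_a a_le jn wL.
have logE : logn 2 (n * 2 ^ (a + (j + 2 ^ t * w)))
    = (j + logn 2 n) + 2 ^ t * (w + 2 ^ 2 ^ (t * t) * a').
  by rewrite lognM ?expn_gt0 // pfactorK // def_a /period_log expnD; lia.
have levelE : level (logn 2 (n * 2 ^ (a + (j + 2 ^ t * w)))) = t.
  apply: level_eq; rewrite lognM ?expn_gt0 // pfactorK //.
  apply/andP; split; first by apply: leq_trans le_a _; lia.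
  apply: leq_trans a_le; rewrite /period_log expnD.
  have : 2 ^ t * w.+1 <= 2 ^ t * 2 ^ 2 ^ (t * t) by rewrite leq_mul2l wL orbT.
  rewrite mulnS; lia.
rewrite /colour levelE; have -> : slot t (n * 2 ^ (a + (j + 2 ^ t * w))) = slot t (n * 2 ^ j).
  rewrite (_ : a + _ = j + 2 ^ t * (w + 2 ^ 2 ^ (t * t) * a')) ?slot_mul_pow2 //.
  by rewrite def_a /period_log expnD; lia.
rewrite logE expnD divnMA addnC mulnC divnMDl ?expn_gt0 // [_ %/ 2 ^ t]divn_small //.
by rewrite addn0 odd_divn_pow2D ?slot_lt.
Qed.

(** Multiplication by n translates the digits of the slot modulo 2 ^ t; the
    exponents of u and v are below 2 ^ t and their primes below t, so the
    slots still determine them. *)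
Lemma slot_separates t u v n :
  0 < u -> 0 < v -> 0 < n -> u < t -> v < t -> slot t (u * n) = slot t (v * n) ->
  u = v.
Proof.
move=> u0 v0 n0 ut vt /slot_inj eq_s; apply: eqn_from_log => // p.
have small m : 0 < m -> m < t -> logn p m < 2 ^ t.
  move=> m0 mt; apply: ltn_trans (ltn_logl _ m0) _.
  exact: ltn_trans mt (ltn_expl _ _).
have [pt|tp] := ltnP p t.
  have /eqP := eq_s p pt; rewrite !lognM // eqn_modDr.
  by rewrite !modn_small ?small // => /eqP.
have big m : 0 < m -> m < t -> logn p m = 0.
  move=> m0 mt; apply/eqP; rewrite -leqn0 leqNgt logn_gt0 mem_primes m0 /=.
  by apply/negP => /andP[_] /(dvdn_leq m0); lia.
by rewrite !big.
Qed.

(** Only the last h indices contribute.  This bounds both the residues that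
    produce carries and the boundary of a box. *)
Lemma sum_tail_le M h : \sum_(j < M) (M <= j + h) <= h.
Proof.
(* the bound by M is needed for the induction on M to go through *)
suff : \sum_(j < M) (M <= j + h) <= minn M h by lia.
elim: M => [|M IHM]; first by rewrite big_ord0.
rewrite big_ord_recl /=.
under eq_bigr do rewrite addSn ltnS.
rewrite add0n; move: IHM; set S := \sum_(j < M) _.
by case: (ltnP M h) => Mh IHM; lia.
Qed.

Local Open Scope ring_scope.

(** The line through n has direction the prime 2; at its point of parameter k
    the pattern B is compared with the colours of the translates by the u i, and
    the expected frequency is subtracted. *)
Definition excess (R : realType) (I : finType) (u : I -> nat) (B : I -> bool)
    (n k : nat) : R :=
  [forall i, colour (u i * n * 2 ^ k) == B i]%:R - 2^-1 ^+ #|I|.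

Lemma excess_le1 (R : realType) (I : finType) (u : I -> nat) (B : I -> bool) n k :
  `|excess R u B n k| <= 1.
Proof.
rewrite /excess; set b := [forall _, _].
have c0 : 0 <= 2^-1 ^+ #|I| :> R by rewrite exprn_ge0 // invr_ge0.
have c1 : 2^-1 ^+ #|I| <= 1 :> R by rewrite exprn_ile1 ?invr_ge0 ?invf_le1 ?ler1n.
move: c0 c1; set c := _ ^+ _ => c0 c1.
by rewrite ler_norml; case: b => /=; rewrite ?mulr1n ?mulr0n; apply/andP; split; lra.
Qed.

(** For a residue j that produces no carry the pattern has exactly the expected
    frequency, uniformly in n. *)
Lemma excess_residue (R : realType) (I : finType) (u : I -> nat) (B : I -> bool)
    U t a n j :
  injective u -> (forall i, 0 < u i < U)%N -> (U <= t)%N -> odd n ->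
  (2 ^ period_log t %| a)%N -> (4 ^ period_log t <= a)%N ->
  (a + 2 ^ period_log t <= 4 ^ period_log t.+1)%N -> (j + U <= 2 ^ t)%N ->
  \sum_(w < 2 ^ 2 ^ (t * t)) excess R u B n (a + (j + 2 ^ t * w)) = 0.
Proof.
move=> u_inj uU Ut n_odd dv_a le_a a_le jU.
have n0 : (0 < n)%N by case: n n_odd.
have un0 i : (0 < u i * n)%N by rewrite muln_gt0 n0; case/andP: (uU i) => ->.
pose c i := slot t (u i * n * 2 ^ j).
have logu i : (j + logn 2 (u i * n) < 2 ^ t)%N.
  have /andP[u0 ui] := uU i.
  rewrite lognM // [X in (_ + (_ + X))%N](_ : _ = 0%N).
    by have := ltn_logl 2 u0; lia.
  by apply/eqP; rewrite -leqn0 leqNgt logn_gt0 mem_primes dvdn2 n_odd !andbF.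
rewrite /excess sumrB sumr_const card_ord.
under eq_bigr => w _.
  have -> : [forall i, colour (u i * n * 2 ^ (a + (j + 2 ^ t * w))) == B i]
      = [forall i, odd (w %/ 2 ^ c i) == B i].
    by apply: eq_forallb => i; rewrite colour_period.
  over.
have c_inj : injective c.
  move=> i i'; rewrite /c -!mulnA => /slot_separates eq_u; apply: u_inj.
  have /andP[? ?] := uU i; have /andP[? ?] := uU i'.
  by apply: eq_u; rewrite ?muln_gt0 ?n0 ?expn_gt0 //; lia.
have := count_bits B c_inj (fun i => slot_lt t _).
move=> /(congr1 (fun m : nat => m%:R : R)).
rewrite natrM natr_sum natrX => count.
rewrite -[X in _ - X]mulr_natr -count exprVn mulKf ?subrr //.
by rewrite expf_neq0 ?pnatr_eq0.
Qed.

(** At most U residues produce a carry, and each of them accounts for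
    2 ^ 2 ^ (t * t) terms of absolute value at most 1. *)
Lemma excess_period (R : realType) (I : finType) (u : I -> nat) (B : I -> bool)
    U t a n :
  injective u -> (forall i, 0 < u i < U)%N -> (U <= t)%N -> odd n ->
  (2 ^ period_log t %| a)%N -> (4 ^ period_log t <= a)%N ->
  (a + 2 ^ period_log t <= 4 ^ period_log t.+1)%N ->
  `|\sum_(k < 2 ^ period_log t) excess R u B n (a + k)|
    <= (U * 2 ^ 2 ^ (t * t))%:R.
Proof.
move=> u_inj uU Ut n_odd dv_a le_a a_le.
have -> : \sum_(k < 2 ^ period_log t) excess R u B n (a + k)
    = \sum_(j < 2 ^ t) \sum_(w < 2 ^ 2 ^ (t * t)) excess R u B n (a + (j + 2 ^ t * w)).
  by rewrite expnD (big_split_residue _ _ _ (fun k => excess R u B n (a + k))).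
apply: le_trans (ler_norm_sum _ _ _) _.
apply: (@le_trans _ _ (\sum_(j < 2 ^ t) ((2 ^ t < j + U) * 2 ^ 2 ^ (t * t))%N%:R)).
  apply: ler_sum => j _; case: leqP => jU.
    by rewrite (excess_residue R B u_inj uU Ut n_odd dv_a le_a a_le jU) ?normr0.
  rewrite mul1n; apply: le_trans (ler_norm_sum _ _ _) _.
  apply: le_trans (ler_sum _ (fun w _ => excess_le1 R u B n _)) _.
  by rewrite sumr_const card_ord.
rewrite -natr_sum ler_nat -big_distrl leq_mul2r /=; apply/orP; right.
apply: leq_trans (sum_tail_le (2 ^ t) U); apply: leq_sum => j _.
by case: (ltnP (2 ^ t) _) => // /ltnW ->.
Qed.

(** * Uniform frequency along lines *)

(** Starting from a0, cut the integers into consecutive blocks of small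
    relative length on which psi has small mean.  Up to N, the initial segment
    costs a0, the complete blocks cost delta * N, and the incomplete last block
    costs its length, again at most delta * N. *)
Lemma greedy_sum_bound (R : realType) (psi : nat -> R) (good : nat -> Prop)
    (delta : R) a0 :
  0 <= delta -> (forall k, `|psi k| <= 1) -> good a0 ->
  (forall a, good a -> exists l, [/\ (0 < l)%N, good (a + l)%N,
     l%:R <= delta * a%:R & `|\sum_(k < l) psi (a + k)%N| <= delta * l%:R]) ->
  forall N, `|\sum_(k < N) psi k| <= a0%:R + 2 * delta * N%:R.
Proof.
move=> d0 psi1 good0 step N.
have splitS a l : \sum_(k < a + l) psi k
    = \sum_(k < a) psi k + \sum_(k < l) psi (a + k)%N by rewrite big_split_ord.
have triv a l : `|\sum_(k < l) psi (a + k)%N| <= l%:R.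
  apply: le_trans (ler_norm_sum _ _ _) _.
  by apply: le_trans (ler_sum _ (fun w _ => psi1 _)) _; rewrite sumr_const card_ord.
have [Na0|a0N] := leqP N a0.
  have := triv 0%N N; under eq_bigr do rewrite add0n.
  have : N%:R <= a0%:R :> R by rewrite ler_nat.
  have : 0 <= N%:R :> R by [].
  nra.
suff main d a : (N - a <= d)%N -> (a <= N)%N -> good a ->
    `|\sum_(k < a) psi k| <= a0%:R + delta * a%:R ->
    `|\sum_(k < N) psi k| <= a0%:R + 2 * delta * N%:R.
  apply: (main N a0) => //; [exact: leq_subr | exact: ltnW |].
  have := triv 0%N a0; under eq_bigr do rewrite add0n.
  have : 0 <= a0%:R :> R by [].
  nra.
have leR m n : (m <= n)%N -> m%:R <= n%:R :> R by rewrite ler_nat.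
(* the blocks are consumed one by one until the current one contains N *)
elim: d a => [|d IHd] a Nad aN good_a Sa;
  have [l [l0 good_al l_le Sl]] := step a good_a;
  have [alN|Nal] := leqP (a + l)%N N; try by lia.
2: {
  apply: (IHd (a + l)%N) => //; first by lia.
  rewrite splitS natrD; apply: le_trans (ler_normD _ _) _; nra. }
all: rewrite -(subnKC aN) splitS; apply: le_trans (ler_normD _ _) _.
all: have := triv a (N - a)%N; have : (N - a)%:R <= l%:R :> R by apply: leR; lia.
all: rewrite (subnKC aN); have := leR _ _ aN; nra.
Qed.

(** The frequency along a line converges uniformly over the lines: N0 depends on
    u and eps, but not on n. *)
Lemma excess_mean (R : realType) (I : finType) (u : I -> nat) (B : I -> bool)
    (eps : R) :
  injective u -> (forall i, 0 < u i)%N -> 0 < eps ->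
  exists N0, forall N n, (N0 <= N)%N -> odd n ->
    `|\sum_(k < N) excess R u B n k| <= eps * N%:R.
Proof.
move=> u_inj u0 eps0.
pose U := (\max_i u i).+1; pose delta := eps / 3.
have uU i : (0 < u i < U)%N by rewrite u0 /U ltnS leq_bigmax.
have d0 : 0 < delta by rewrite divr_gt0.
(* from level t0 on, U carries are a proportion at most delta of 2 ^ t *)
pose t0 := maxn U (Num.truncn (U%:R / delta)).+1.
have good_start t : (t0 <= t)%N -> U%:R <= delta * (2 ^ t)%:R.
  move=> t0t; rewrite mulrC -ler_pdivrMr //; apply: ltW.
  apply: lt_le_trans (truncnS_gt _) _; rewrite ler_nat.
  apply: leq_trans (ltnW (ltn_expl t (isT : (1 < 2)%N))).
  by apply: leq_trans t0t; rewrite leq_maxr.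
pose good a := exists t, [/\ (t0 <= t)%N, (2 ^ period_log t %| a)%N,
  (4 ^ period_log t <= a)%N & (a < 4 ^ period_log t.+1)%N].
pose a0 := (4 ^ period_log t0)%N.
have plS t : (period_log t < period_log t.+1)%N.
  by rewrite /period_log addSn ltnS leq_add // leq_exp2l // leq_mul.
have dvd4 s t : (s <= period_log t)%N -> (2 ^ s %| 4 ^ period_log t)%N.
  move=> st; rewrite -[4%N]/(2 ^ 2)%N -expnM dvdn_exp2l //; lia.
exists (Num.truncn (a0%:R / delta)).+1 => N n leN n_odd.
have a0N : a0%:R <= delta * N%:R.
  rewrite mulrC -ler_pdivrMr //; apply: ltW; apply: lt_le_trans (truncnS_gt _) _.
  by rewrite ler_nat.
apply: (@le_trans _ _ (a0%:R + 2 * delta * N%:R)); last first.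
  have -> : eps = 3 * delta by rewrite /delta; lra.
  nra.
apply: (@greedy_sum_bound _ _ good); first exact: ltW.
- by move=> k; apply: excess_le1.
- by exists t0; split=> //; [apply: dvd4|rewrite ltn_exp2l].
move=> a [t [t0t dv_a le_a lt_a]]; exists (2 ^ period_log t)%N.
(* the threshold of the next level is a multiple of the current period, so
   that no period straddles it *)
have a_le : (a + 2 ^ period_log t <= 4 ^ period_log t.+1)%N.
  have := dvd4 _ _ (ltnW (plS t)); move: lt_a dv_a.
  move: (2 ^ period_log t)%N => P lt_a /dvdnP[b def_a] /dvdnP[c def_c].
  by move: lt_a; rewrite def_a def_c -mulSnr ltn_pmul2r ?leq_mul2r; lia.
have Ut : (U <= t)%N by apply: leq_trans t0t; rewrite leq_maxl.
have Ud := good_start t t0t.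
split.
- by rewrite expn_gt0.
- have [lt_al|le_al] := ltnP (a + 2 ^ period_log t)%N (4 ^ period_log t.+1)%N.
    exists t; split=> //; first by rewrite dvdn_addr.
    by apply: leq_trans le_a _; rewrite leq_addr.
  exists t.+1; have -> : (a + 2 ^ period_log t = 4 ^ period_log t.+1)%N.
    by apply/eqP; rewrite eqn_leq a_le.
  by split; [exact: leqW | exact: dvd4 | | rewrite ltn_exp2l].
(* the period P satisfies P * P <= a and 1 <= delta * P *)
- have Pa : ((2 ^ period_log t)%:R * (2 ^ period_log t)%:R <= a%:R :> R).
    by rewrite -natrM ler_nat -expnMn.
  have P1 : 1 <= delta * (2 ^ period_log t)%:R.
    apply: le_trans (_ : U%:R <= _); first by rewrite ler1n.
    apply: le_trans Ud _; rewrite ler_pM2l // ler_nat leq_exp2l //.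
    exact: leq_addr.
  have P0 : 0 <= (2 ^ period_log t)%:R :> R by [].
  nra.
apply: le_trans (excess_period R B u_inj uU Ut n_odd dv_a le_a a_le) _.
by rewrite /period_log expnD !natrM mulrA ler_wpM2r.
Qed.

(** * Exponents and boxes *)

Local Open Scope nat_scope.

Lemma nth_prime_prime i : prime (nth_prime i).
Proof. by rewrite /nth_prime iterS /next_prime; case: ex_minnP => p /andP[]. Qed.

Lemma nth_primeS i : nth_prime i < nth_prime i.+1.
Proof.
by rewrite {2}/nth_prime iterS -/(nth_prime i) /next_prime; case: ex_minnP => p /andP[].
Qed.

Lemma nth_prime0 : nth_prime 0 = 2.
Proof.
rewrite /nth_prime /= /next_prime; case: ex_minnP => p /andP[_ /prime_gt1 p1].
by move=> /(_ 2 isT); lia.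
Qed.

Lemma nth_prime_inj : injective nth_prime.
Proof. by apply: incn_inj; apply: leq_mono; apply: (homo_ltn ltn_trans nth_primeS). Qed.

Lemma ltn_nth_prime i : i < nth_prime i.
Proof. by elim: i => [|i IHi]; [rewrite nth_prime0|have := nth_primeS i; lia]. Qed.

Lemma gaddgE (g h : GG) i : gcoord (g + h)%R i = g i + h i.
Proof. exact: gaddE. Qed.

Lemma GG_eqP (g h : GG) : (forall i, g i = h i) -> g = h.
Proof. by move=> eq_gh; apply/fsfunP => i; exact: eq_gh. Qed.

Lemma GG_bounded (g : GG) : exists N, forall i, N <= i -> g i = 0.
Proof.
exists (\max_(i <- finsupp g) i).+1 => i Ni.
rewrite /gcoord fsfun_dflt //; apply/negP => ig; move: Ni.
by rewrite ltnNge => /negP; apply; apply: leq_bigmax_seq.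
Qed.

(** The product may be taken over any initial segment containing the support,
    so that two elements can be compared over a common range. *)
Lemma godel_prod (g : GG) N : (forall i, N <= i -> g i = 0) ->
  godel g = \prod_(i < N) nth_prime i ^ g i.
Proof.
move=> gN; rewrite /godel -(big_mkord xpredT (fun i => nth_prime i ^ g i)).
rewrite [RHS](bigID (fun i => i \in finsupp g)) /= [X in _ * X]big1 ?muln1; last first.
  by move=> i; move=> /fsfun_dflt gi; rewrite /gcoord gi.
rewrite -[RHS]big_filter; apply: perm_big; apply: uniq_perm.
- exact: fset_uniq.
- by rewrite filter_uniq // iota_uniq.
move=> i; rewrite mem_filter mem_index_iota /=; case: (boolP (i \in _)) => //= ig.
apply/esym; rewrite ltnNge; apply/negP => /gN gi.
by move: ig; rewrite mem_finsupp -/(gcoord g i) gi eqxx.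
Qed.

Lemma godelD (g h : GG) : godel (g + h)%R = godel g * godel h.
Proof.
have [N gN] := GG_bounded g; have [M hM] := GG_bounded h.
have gNM i : N + M <= i -> g i = 0 by move=> ?; apply: gN; lia.
have hNM i : N + M <= i -> h i = 0 by move=> ?; apply: hM; lia.
rewrite (godel_prod gNM) (godel_prod hNM) -big_split /= (@godel_prod _ (N + M)).
  by apply: eq_bigr => i _; rewrite gaddgE expnD.
by move=> i Ni; rewrite gaddgE gNM ?hNM.
Qed.

Lemma godel_gt0 (g : GG) : 0 < godel g.
Proof.
rewrite /godel; apply: prodn_gt0 => i.
by rewrite expn_gt0 prime_gt0 ?nth_prime_prime.
Qed.

Lemma logn_godel (g : GG) i : logn (nth_prime i) (godel g) = g i.
Proof.
have [N gN] := GG_bounded g.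
suff logE M : logn (nth_prime i) (\prod_(j < M) nth_prime j ^ g j)
    = (i < M) * g i.
  rewrite (godel_prod gN) logE; case: ltnP; rewrite ?mul1n // => /gN ->.
  by rewrite muln0.
elim: M => [|M IHM]; first by rewrite big_ord0 logn1.
have pexp_gt0 j : 0 < nth_prime j ^ g j.
  by rewrite expn_gt0 prime_gt0 ?nth_prime_prime.
rewrite big_ord_recr /= lognM ?prodn_gt0 //.
rewrite IHM lognX logn_prime ?nth_prime_prime // (inj_eq nth_prime_inj).
have -> : (i < M.+1) = (i == M) || (i < M) by rewrite ltnS leq_eqVlt.
case: (eqVneq i M) => [->|_] /=; first by rewrite ltnn mul1n muln1.
by rewrite muln0 addn0.
Qed.

Lemma godel_inj : injective godel.
Proof. by move=> g h eq_gh; apply: GG_eqP => i; rewrite -!logn_godel eq_gh. Qed.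

Lemma coord_lt_godel (g : GG) i : g i < godel g.
Proof. by rewrite -logn_godel ltn_logl ?godel_gt0. Qed.

Lemma coord_eq0 (g : GG) i : godel g <= i -> g i = 0.
Proof.
move=> gi; apply/eqP; rewrite -leqn0 leqNgt -logn_godel logn_gt0 mem_primes.
apply/negP => /and3P[_ _ /(dvdn_leq (godel_gt0 g))].
by have := ltn_nth_prime i; lia.
Qed.

Definition gsingle i j : GG := [fsfun x in [fset i]%fset => j].

Lemma gsingleE i j x : gsingle i j x = if x == i then j else 0.
Proof. by rewrite /gcoord /gsingle fsfunE inE. Qed.

Lemma godel_gsingle0 j : godel (gsingle 0 j) = 2 ^ j.
Proof.
rewrite (@godel_prod _ 1) => [|i]; last by rewrite gsingleE; case: i.
by rewrite big_ord1 gsingleE nth_prime0.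
Qed.

Lemma mem_anchored_box (F : {fset GG}) k : [set` F]%classic = anchored_box k ->
  forall g : GG, g \in F <-> forall i, g i <= nth 0 k i.
Proof.
move=> Fk g; have := congr1 (fun X : set GG => X g) Fk.
by rewrite /anchored_box /= => ->.
Qed.

(** A box is the product of a segment in direction i and of its face of
    elements whose coordinate i is 0. *)
Lemma sum_box_fibers (V : nmodType) (F : {fset GG}) k (phi : GG -> V) i :
  [set` F]%classic = anchored_box k ->
  (\sum_(g <- F) phi g
   = \sum_(g <- F | gcoord g i == 0%N) \sum_(j < (nth 0%N k i).+1) phi (g + gsingle i j))%R.
Proof.
move=> /mem_anchored_box memF.
pose f (g : GG) (j : nat) : GG := (g + gsingle i j)%R.
transitivity (\sum_(x <- [seq f g j | g <- [seq g : GG <- F | g i == 0],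
                              j <- index_iota 0 (nth 0 k i).+1]) phi x)%R; last first.
  by rewrite big_allpairs_dep big_filter; apply: eq_bigr => g _; rewrite big_mkord.
apply: perm_big; apply: uniq_perm; first exact: fset_uniq.
  apply: allpairs_uniq; rewrite ?filter_uniq ?fset_uniq ?iota_uniq //.
  move=> _ _ /allpairsP[[g j] [gF _ ->]] /allpairsP[[h l] [hF _ ->]] /= eq_gh.
  have coordE x : gcoord g x + gsingle i j x = gcoord h x + gsingle i l x.
    by rewrite -!gaddgE -/(f g j) eq_gh.
  move: gF hF; rewrite !mem_filter /= => /andP[/eqP gi _] /andP[/eqP hi _].
  have jl : j = l by have := coordE i; rewrite !gsingleE eqxx gi hi.
  congr (_, _) => //; apply: GG_eqP => x; have := coordE x.
  by rewrite jl => /addIn.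
move=> g; apply/idP/allpairsP => [gF|[[h j] [/=]]]; last first.
  rewrite mem_filter mem_index_iota => /andP[/eqP hi /memF hF] /= ji ->.
  apply/memF => x; rewrite gaddgE gsingleE; case: eqP => [->|_].
    by rewrite hi.
  by rewrite addn0.
pose g0 : GG := [fsfun g with i |-> 0].
have g0E x : g0 x = if x == i then 0 else g x by rewrite /g0 /gcoord fsfun_withE.
exists (g0, g i); rewrite mem_filter mem_index_iota /= g0E eqxx ltnS; split.
- apply/memF => x; rewrite g0E; case: eqP => // _.
  exact: (proj1 (memF g) gF x).
- exact: (proj1 (memF g) gF i).
- apply: GG_eqP => x; rewrite gaddgE g0E gsingleE.
  by case: eqP => [->|_]; rewrite ?addn0.
Qed.

(** The injective function [godel] is bounded on a box by its value at the
    largest element. *)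
Lemma finite_anchored_box k : finite_set (anchored_box k).
Proof.
pose M := \prod_(i < size k) nth_prime i ^ nth 0 k i.
have : finite_set (godel @^-1` [set n | n < M.+1])%classic.
  by apply: finite_preimage => [g h _ _ /godel_inj|] //; exact: finite_II.
apply: sub_finite_set => g /= gk; rewrite ltnS (@godel_prod _ (size k)).
  by apply: leq_prod => i _; rewrite leq_exp2l ?prime_gt1 ?nth_prime_prime.
by move=> i ki; apply/eqP; rewrite -leqn0; have := gk i; rewrite nth_default.
Qed.

(** * Net-normality *)

Local Open Scope ring_scope.

Lemma card_box_fibers (R : realType) (F : {fset GG}) k i :
  [set` F]%classic = anchored_box k ->
  (#|` F|%fset)%:R = \sum_(g <- F | gcoord g i == 0%N) (nth 0%N k i).+1%:R :> R.
Proof.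
move=> Fk; have := sum_box_fibers (fun=> 1 : R) i Fk.
rewrite big_const_seq count_predT iter_addr_0 => ->.
by apply: eq_bigr => g _; rewrite sumr_const card_ord.
Qed.

(** On every fibre in direction i at most h points out of the length of the
    side leave the box when translated by h. *)
Lemma box_boundary_le (R : realType) (F : {fset GG}) k i h (eta : R) :
  [set` F]%classic = anchored_box k -> h%:R <= eta * (nth 0%N k i).+1%:R ->
  \sum_(g <- F) (nth 0%N k i < gcoord g i + h)%N%:R <= eta * (#|` F|%fset)%:R.
Proof.
move=> Fk h_le.
rewrite (sum_box_fibers _ i Fk) (card_box_fibers R i Fk) mulr_sumr.
apply: ler_sum => g /eqP gi; apply: le_trans h_le.
rewrite -natr_sum ler_nat; apply: leq_trans (sum_tail_le (nth 0%N k i).+1 h).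
by apply: leq_sum => j _; rewrite gaddgE gi gsingleE eqxx add0n.
Qed.

Lemma odd_godel (g : GG) : g 0%N = 0%N -> odd (godel g).
Proof.
move=> g0; rewrite -[odd _]negbK -dvdn2; apply/negP => dv.
have : (0 < logn 2 (godel g))%N by rewrite logn_gt0 mem_primes godel_gt0.
by rewrite -nth_prime0 logn_godel g0.
Qed.

Definition matches (K : {fset GG}) (B : {ffun K -> bool}) (g : GG) : bool :=
  [forall h : K, colour (godel (val h + g)%R) == B h].

(** An estimate valid along all lines passes to the box.  The hypothesis is
    restricted to odd n because a fibre starts at exponent 0 of the prime 2. *)
Lemma box_matches_le (R : realType) (K : {fset GG}) (B : {ffun K -> bool})
    (F : {fset GG}) k (eta : R) :
  [set` F]%classic = anchored_box k ->
  (forall n, odd n -> `|\sum_(j < (nth 0%N k 0).+1)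
       excess R (fun h : K => godel (val h)) B n j| <= eta * (nth 0%N k 0).+1%:R) ->
  `|\sum_(g <- F) ((matches B g)%:R - 2^-1 ^+ #|` K|%fset)| <= eta * (#|` F|%fset)%:R.
Proof.
move=> Fk mean.
rewrite (sum_box_fibers _ 0%N Fk) (card_box_fibers R 0%N Fk) mulr_sumr.
apply: le_trans (ler_norm_sum _ _ _) _; apply: ler_sum => g /eqP /odd_godel g_odd.
apply: le_trans (mean _ g_odd); rewrite le_eqVlt; apply/orP; left; apply/eqP.
congr `|_|; apply: eq_bigr => j _; rewrite /excess cardfE; congr (_%:R - _).
congr nat_of_bool; apply: eq_forallb => h.
by rewrite addrA !godelD godel_gsingle0.
Qed.

(** As K has an element and boxes are downward closed, a translate of K inside
    the box starts at a point of the box. *)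
Lemma occurrencesE (K : {fset GG}) (B : {ffun K -> bool}) (x : GG -> bool)
    (F : {fset GG}) k :
  [set` F]%classic = anchored_box k -> K != fset0%fset ->
  occurrences B x F
  = (\sum_(g <- F) [forall h : K, ((val h + g)%R \in F) && (x (val h + g)%R == B h)])%N.
Proof.
move=> Fk /fset0Pn[h0 h0K]; rewrite /occurrences.
pose P (g : GG) := [forall h : K, ((val h + g)%R \in F) && (x (val h + g)%R == B h)].
rewrite (_ : [set g | _]%classic = [set` [fset g in F | P g]%fset]%classic).
  rewrite set_fsetK card_fset_sum1 -big_fset_condE big_mkcond /=.
  by apply: eq_bigr => g _; rewrite /P; case: ifP.
apply/seteqP; split => g /=; rewrite !inE /=.
  move=> Hg; apply/andP; split; last first.
    by apply/forallP => h; have [-> ->] := Hg h; rewrite eqxx.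
  have [hF _] := Hg (FSetSub h0K); apply/(mem_anchored_box Fk) => i.
  have := proj1 (mem_anchored_box Fk _) hF i; rewrite gaddgE.
  by apply: leq_trans; rewrite leq_addl.
by move=> /andP[_ /forallP Pg] h; have /andP[-> /eqP] := Pg h.
Qed.

(** A translate by K that leaves the box does so in one of the directions
    i < U, since the elements of K vanish in the others; the bound on [godel]
    controls both the directions and the lengths of the translations. *)
Lemma box_shift_bad_le (R : realType) (K F : {fset GG}) k U (eta : R) :
  [set` F]%classic = anchored_box k ->
  (forall h : K, (godel (val h) <= U)%N) ->
  (forall i, (i < U)%N -> U%:R <= eta * (nth 0%N k i).+1%:R) ->
  \sum_(g <- F) (~~ [forall h : K, (val h + g)%R \in F])%:R
    <= (#|` K|%fset * U)%:R * eta * (#|` F|%fset)%:R.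
Proof.
move=> Fk KU U_le.
apply: (@le_trans _ _ (\sum_(g <- F) \sum_(h : K) \sum_(i < U)
   (nth 0%N k i < gcoord g i + gcoord (val h) i)%N%:R)).
  rewrite !big_seq; apply: ler_sum => g gF.
  case: forallP => [_|/forallP]; first by apply: sumr_ge0 => h _; apply: sumr_ge0.
  rewrite negb_forall => /existsP[h hgF].
  have [i iU hgi] : exists2 i : 'I_U, true & (nth 0%N k i < gcoord g i + gcoord (val h) i)%N.
    apply: contraNP hgF => noi; apply/(mem_anchored_box Fk) => i; rewrite gaddgE.
    have [iU|Ui] := ltnP i U.
      by rewrite leqNgt addnC; apply/negP => lt_i; apply: noi; exists (Ordinal iU).
    rewrite coord_eq0 ?add0n; last exact: leq_trans (KU h) Ui.
    exact: (proj1 (mem_anchored_box Fk g) gF i).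
  rewrite (bigD1 h) //= (bigD1 i) //= hgi -!addrA lerDl addr_ge0 ?sumr_ge0 // => *.
  exact: sumr_ge0.
rewrite exchange_big /=.
under eq_bigr do rewrite exchange_big /=.
apply: (@le_trans _ _ (\sum_(h : K) \sum_(i < U) eta * (#|` F|%fset)%:R)).
  apply: ler_sum => h _; apply: ler_sum => i _; apply: box_boundary_le => //.
  apply: le_trans (U_le i (ltn_ord i)); rewrite ler_nat.
  exact: leq_trans (ltnW (coord_lt_godel _ _)) (KU h).
by rewrite !sumr_const card_ord -mulrnA mulnC -[X in X <= _]mulr_natl mulrA (cardfE K).
Qed.

Lemma mem_colour (g : GG) :
  (g \in [set h : GG | colour (godel h)]%classic) = colour (godel g).
Proof. by apply/idP/idP; rewrite inE. Qed.

Lemma net_normal_colour (R : realType) :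
  net_normal R [set g : GG | colour (godel g)]%classic.
Proof.
move=> K B K0 eps eps0.
pose U := (\max_(h : K) godel (val h)).+1.
have KU (h : K) : (godel (val h) <= U)%N by apply: leqW; apply: leq_bigmax.
have Kpos : 0 < (#|` K|%fset * U)%:R :> R.
  by rewrite ltr0n muln_gt0 andbT cardfs_gt0.
pose eta := eps / 3 / (#|` K|%fset * U)%:R.
have eta0 : 0 < eta by rewrite !divr_gt0.
have [N0 mean] := @excess_mean R K (fun h => godel (val h)) B (eps / 3)
   (inj_comp godel_inj val_inj) (fun h => godel_gt0 _) (divr_gt0 eps0 (ltr0n _ 3)).
(* long enough for the mean along lines and for the boundary in each of the U
   directions *)
pose M := maxn N0 (Num.truncn (U%:R / eta)).+1.
have fsK := fset_setK (finite_anchored_box (nseq U M)).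
exists (fset_set (anchored_box (nseq U M))); first by exists (nseq U M).
move=> F [k Fk] /fsubsetP F0F.
have kM i : (i < U)%N -> (M <= nth 0%N k i)%N.
  move=> iU; have := proj1 (mem_anchored_box Fk (gsingle i M)).
  move=> /(_ _ i); rewrite gsingleE eqxx; apply; apply: F0F.
  apply/(mem_anchored_box fsK) => j; rewrite gsingleE nth_nseq.
  by case: eqP => [->|_]; rewrite ?iU.
have sizeF : 0 < (#|` F|%fset)%:R :> R.
  rewrite ltr0n cardfs_gt0; apply/fset0Pn; exists gzero.
  by apply/(mem_anchored_box Fk) => i; rewrite gzeroE.
have main := @box_matches_le R K B F k (eps / 3) Fk.
have bad := @box_shift_bad_le R K F k U eta Fk KU.
set c := 2^-1 ^+ _; set occ := occurrences _ _ _.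
suff : `|occ%:R - c * (#|` F|%fset)%:R| < eps * (#|` F|%fset)%:R.
  have -> : occ%:R / (#|` F|%fset)%:R - c
      = (occ%:R - c * (#|` F|%fset)%:R) / (#|` F|%fset)%:R.
    by rewrite mulrBl mulfK ?gt_eqF.
  by rewrite normrM normfV (gtr0_norm sizeF) ltr_pdivrMr.
pose inside (g : GG) := [forall h : K, (val h + g)%R \in F].
(* counting all matches overcounts by the matches whose translate leaves F *)
have occE : occ%:R - c * (#|` F|%fset)%:R =
    \sum_(g <- F) ((matches B g)%:R - c)
    - \sum_(g <- F) (matches B g && ~~ inside g)%:R.
  have <- : \sum_(g <- F) c = c * (#|` F|%fset)%:R.
    by rewrite big_const_seq count_predT iter_addr_0 mulr_natr.
  rewrite /occ (occurrencesE _ _ Fk K0) natr_sum -!sumrB; apply: eq_bigr => g _.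
  have -> : [forall h : K, ((val h + g)%R \in F)
      && (((val h + g)%R \in [set g : GG | colour (godel g)]%classic) == B h)]
      = inside g && matches B g.
    apply/forallP/andP => [Pg|[/forallP Ig /forallP Mg] h]; last first.
      by rewrite mem_colour Ig Mg.
    by split; apply/forallP => h; have := Pg h; rewrite mem_colour => /andP[].
  case: (inside g) (matches B g) => [] [] /=; rewrite ?mulr1n ?mulr0n; lra.
rewrite occE; apply: le_lt_trans (ler_normB _ _) _.
have mainb : `|\sum_(g <- F) ((matches B g)%:R - c)| <= eps / 3 * (#|` F|%fset)%:R.
  apply: main => n n_odd; apply: mean => //.
  by apply: leq_trans (leqW (kM 0%N isT)); rewrite leq_maxl.
have badb : `|\sum_(g <- F) (matches B g && ~~ inside g)%:R|
    <= eps / 3 * (#|` F|%fset)%:R.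
  rewrite ger0_norm ?sumr_ge0 //; apply: (@le_trans _ _ (\sum_(g <- F) (~~ inside g)%:R)).
    by apply: ler_sum => g _; rewrite ler_nat; case: (matches B g).
  have -> : eps / 3 = (#|` K|%fset * U)%:R * eta.
    by rewrite /eta [RHS]mulrC divfK ?gt_eqF.
  apply: bad => i iU; rewrite mulrC -ler_pdivrMr //; apply: ltW.
  apply: lt_le_trans (truncnS_gt _) _; rewrite ler_nat.
  by apply: leq_trans (leqW (kM i iU)); rewrite leq_maxr.
nra.
Qed.

Theorem theorem6p8 :
  exists A : set GG,
    effectively_defined A /\ forall R : realType, net_normal R A.
Proof.
exists [set g : GG | colour (godel g)]%classic; split; last exact: net_normal_colour.
exists (fun v : 1.-tuple nat => colour (tnth v ord0)); first exact: recursive_colour.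
by move=> g; rewrite mem_colour.
Qed.
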